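(* Let $a,b,c,d$ be integers and let $k$ be a nonzero integer such that $3\nmid v_2(k)$ and such that $a$ and $bc+d$ are odd. Suppose that the polynomial $aX^3+bX^2+cX+d$ is irreducible over $\mathbb{Q}$ and that its discriminant is a perfect square. Then the cubic Thue equation \[ ax^3+bx^2y+cxy^2+dy^3=k\] has no integer solution $(x,y)\in\mathbb{Z}^2$.
   Context: For a nonzero integer $k$, $v_2(k)$ denotes the $2$-adic valuation of $k$, i.e. the exponent of the largest power of $2$ dividing $k$. *)

(* Defs.v *)
From HB Require Import structures.
From mathcomp Require Import all_boot all_order all_algebra.
From mathcomp Require Import ring.

Set Implicit Arguments.
Unset Strict Implicit.
Unset Printing Implicit Defensive.

Import Order.TTheory GRing.Theory Num.Theory.
Local Open Scope ring_scope.

Definition cubic (R : nzRingType) (a b c d : R) : {poly R} :=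
  a *: 'X^3 + b *: 'X^2 + c *: 'X + d%:P.

(* For p of degree n, disc(p) = (-1)^(n(n-1)/2) Res(p, p') / lc(p).
   MathComp's Sylvester matrix lists coefficients in ascending order, which
   changes the usual Res(p, q) by the sign (-1)^(deg p * deg q); for q = p' in
   characteristic 0 the exponent n(n-1) is even, so the two agree.  *)
Definition discriminant (F : numFieldType) (p : {poly F}) : F :=
  (-1) ^+ 'C((size p).-1, 2) * resultant p p^`() / lead_coef p.

Lemma cubicE (R : nzRingType) (a b c d : R) :
  cubic a b c d = Poly [:: d; c; b; a].
Proof.
apply/polyP=> i; rewrite coef_Poly /cubic !coefE.
by case: i => [|[|[|[|i]]]] //=; rewrite ?nth_nil ?(mulr0, mulr1, addr0, add0r).
Qed.

Fixpoint laplace (R : nzRingType) n (f : nat -> nat -> R) : R :=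
  if n is m.+1 then
    foldr (fun j s => f 0 j * ((-1) ^+ j *
                        laplace m (fun i k => f i.+1 (bump j k))) + s)
      0 (iota 0 n)
  else 1.

Lemma laplaceE (R : comNzRingType) n (f : nat -> nat -> R) :
  \det (\matrix_(i < n, j < n) f i j) = laplace n f.
Proof.
elim: n f => [|n IHn] f; first by rewrite det_mx00.
rewrite (expand_det_row _ ord0).
transitivity (\sum_(j < n.+1) f 0 j * ((-1) ^+ j *
                laplace n (fun i k => f i.+1 (bump j k)))).
  apply: eq_bigr => j _; rewrite mxE /cofactor add0n -IHn.
  by congr (_ * (_ * \det _)); apply/matrixP=> i k; rewrite !mxE.
by rewrite -(big_mkord xpredT (fun j => f 0 j * ((-1) ^+ j *
  laplace n (fun i k => f i.+1 (bump j k))))) unlock.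
Qed.

Lemma resultant32 (R : comNzRingType) (p q : {poly R}) :
  size p = 4 -> size q = 3 ->
  resultant p q = laplace 5 (fun i j =>
    if (i < 2)%N then p`_(j - i) *+ (i <= j)
    else q`_(j - (i - 2)) *+ (i - 2 <= j)).
Proof.
rewrite -laplaceE => sp sq; have := @Sylvester_mxE R p q; rewrite /resultant.
move: (Sylvester_mx p q); rewrite sp sq /= => A EA; congr (\det _).
apply/matrixP=> i j; rewrite EA mxE.
case: splitP => k ->; first by rewrite ltn_ord.
by rewrite addKn.
Qed.

Lemma discriminant_cubic (F : numFieldType) (a b c d : F) : a != 0 ->
  discriminant (cubic a b c d) =
  b ^+ 2 * c ^+ 2 - 4 * a * c ^+ 3 - 4 * b ^+ 3 * d - 27 * a ^+ 2 * d ^+ 2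
  + 18 * a * b * c * d.
Proof.
move=> a0; rewrite cubicE; set p := Poly _.
have vp : p = [:: d; c; b; a] :> seq F by rewrite (PolyK (c := 0)).
have dp : p^`() = Poly [:: c; b *+ 2; a *+ 3].
  apply/polyP=> i; rewrite coef_deriv vp coef_Poly.
  by case: i => [|[|[|i]]]; rewrite /= ?nth_nil ?mul0rn.
have vq : p^`() = [:: c; b *+ 2; a *+ 3] :> seq F.
  by rewrite dp (PolyK (c := 0)) //= mulrn_eq0.
have lp : lead_coef p = a by rewrite lead_coefE vp.
rewrite /discriminant lp resultant32 ?vp ?vq //.
rewrite /= /bump /= ?(mulr0n, mulr1n, mul0r, mulr0, add0r, addr0).
by field.
Qed.

(* Main.v *)
(* Write F(x, y) for the cubic form. Modulo 2, the parity hypotheses leave three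
   reductions: one without nontrivial zero, and the two reducible forms
   (x + y)(x^2 + xy + y^2) and x(x^2 + xy + y^2). The last two force the
   discriminant to be 5 modulo 8, so it is not a square. In the first one, a
   solution with k even has x and y even, hence 8 divides k and (x/2, y/2)
   solves the equation for k/8; by descent 3 divides v_2(k). *)
Require Import Defs.
From HB Require Import structures.
From mathcomp Require Import all_boot all_order all_algebra.
From mathcomp Require Import ring zify.

Import Order.TTheory GRing.Theory Num.Theory.
Local Open Scope ring_scope.

Lemma odd_abszD (x y : int) : odd `|(x + y)%R| = odd `|x| (+) odd `|y|.
Proof. lia. Qed.

Lemma odd_abszM (x y : int) : odd `|(x * y)%R| = odd `|x| && odd `|y|.
Proof. by rewrite abszM oddM. Qed.

Lemma odd_abszX (x : int) n : odd `|(x ^+ n)%R| = (n == 0)%N || odd `|x|.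
Proof. by rewrite abszX oddX. Qed.

(** Parity as a ring homomorphism to the booleans: polynomial parities become boolean formulas,
    settled by cases. *)
Definition odd_abszE := (odd_abszD, odd_abszM, odd_abszX).

Lemma odd_absz_ex {x : int} : odd `|x| -> exists q : int, x = 2 * q + 1.
Proof. by move=> ox; exists (x %/ 2)%Z; lia. Qed.

Lemma even_absz_ex {x : int} : ~~ odd `|x| -> exists q : int, x = 2 * q.
Proof. by move=> ex; exists (x %/ 2)%Z; lia. Qed.

Lemma odd_sqr_mod8 {x : int} : odd `|x| -> exists q : int, x ^+ 2 = 8 * q + 1.
Proof.
case/odd_absz_ex=> q ->.
have [r rE] : exists r, q * (q + 1) = 2 * r.
  by apply: even_absz_ex; rewrite !odd_abszE; case: (odd _).
by exists r; transitivity (4 * (q * (q + 1)) + 1); [ring | rewrite rE; ring].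
Qed.

Lemma sqr_neq5_mod8 {m q : int} : m ^+ 2 <> 8 * q + 5.
Proof.
move=> E; have om : odd `|m|.
  by have : odd `|(m ^+ 2)%R|; [rewrite E; lia | rewrite odd_abszX].
by have [r] := odd_sqr_mod8 om; rewrite E; lia.
Qed.

Definition cubic_form (a b c d x y : int) : int :=
  a * x ^+ 3 + b * x ^+ 2 * y + c * x * y ^+ 2 + d * y ^+ 3.

Definition cubic_disc (a b c d : int) : int :=
  b ^+ 2 * c ^+ 2 - 4 * a * c ^+ 3 - 4 * b ^+ 3 * d - 27 * a ^+ 2 * d ^+ 2
  + 18 * a * b * c * d.

(** Modulo 8 only $-27a^2d^2$ survives; odd squares are 1 and $-27 = 8 \cdot (-4) + 5$. *)
Lemma cubic_disc5_even_mid (a b c d : int) :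
  odd `|a| -> ~~ odd `|b| -> ~~ odd `|c| -> odd `|d| ->
  exists q : int, cubic_disc a b c d = 8 * q + 5.
Proof.
move=> /odd_sqr_mod8[A aE] /even_absz_ex[b' ->] /even_absz_ex[c' ->].
move=> /odd_sqr_mod8[D dE].
exists (2 * b' ^+ 2 * c' ^+ 2 - 4 * a * c' ^+ 3 - 4 * b' ^+ 3 * d
  - 27 * (8 * A * D + A + D) - 4 + 9 * a * b' * c' * d).
by rewrite /cubic_disc aE -mulrA dE; ring.
Qed.

(** With $d = 2e$ the discriminant is $1 - 4 + 4(e^2 + e)$ modulo 8, and $e^2 + e$ is even. *)
Lemma cubic_disc5_even_last (a b c d : int) :
  odd `|a| -> odd `|b| -> odd `|c| -> ~~ odd `|d| ->
  exists q : int, cubic_disc a b c d = 8 * q + 5.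
Proof.
move=> oa ob oc /even_absz_ex[e ->].
have [A aE] := odd_sqr_mod8 oa.
have [[B bE] [C cE]] := (odd_sqr_mod8 ob, odd_sqr_mod8 oc).
have [u uE] : exists u, a * c = 2 * u + 1.
  by apply: odd_absz_ex; rewrite !odd_abszE oa oc.
have [w wE] : exists w, a * b * c = 2 * w + 1.
  by apply: odd_absz_ex; rewrite !odd_abszE oa ob oc.
have [v vE] : exists v, e ^+ 2 - e = 2 * v.
  apply: even_absz_ex; have -> : e ^+ 2 - e = e * (e + -1) by ring.
  by rewrite !odd_abszE; case: (odd _).
(* Grouped so that each factor of known residue appears as such; the terms linear in $e$ then add up
   to $-108e + 36e = -72e$ modulo 8. *)
have -> : cubic_disc a b c (2 * e) =
    b ^+ 2 * c ^+ 2 - 4 * (a * c) * c ^+ 2 - 8 * (b ^+ 3 * e)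
    - 108 * a ^+ 2 * (e ^+ 2 - e) - 108 * a ^+ 2 * e + 36 * (a * b * c) * e.
  by rewrite /cubic_disc; ring.
rewrite aE bE cE uE wE vE.
exists (8 * B * C + B + C - 8 * u * C - 4 * C - u - 1 - b ^+ 3 * e
  - 27 * (8 * A + 1) * v - 108 * A * e + 9 * w * e - 9 * e).
ring.
Qed.

Lemma cubic_disc_sqr_parity {a b c d m : int} :
  odd `|a| -> odd `|(b * c + d)%R| -> cubic_disc a b c d = m ^+ 2 ->
  odd `|d| && (odd `|b| (+) odd `|c|).
Proof.
rewrite !odd_abszE => oa + Dm.
have not5 : ~ exists q : int, cubic_disc a b c d = 8 * q + 5.
  by case=> q; rewrite Dm; apply: sqr_neq5_mod8.
(* Two cases remain to be excluded: $b, c$ odd with $d$ even, and $b, c$ even with $d$ odd. *)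
case ob: (odd `|b|); case oc: (odd `|c|); case od: (odd `|d|) => // _; case: not5.
- by apply: cubic_disc5_even_last; rewrite ?od.
- by apply: cubic_disc5_even_mid; rewrite ?ob ?oc.
Qed.

(** Modulo 2 the form is $x^3 + x^2y + y^3$ or $x^3 + xy^2 + y^3$, which equals 1 at $(1,0)$,
    $(0,1)$ and $(1,1)$. *)
Lemma cubic_form_even {a b c d x y : int} :
  odd `|a| -> odd `|d| && (odd `|b| (+) odd `|c|) ->
  ~~ odd `|cubic_form a b c d x y| -> ~~ odd `|x| && ~~ odd `|y|.
Proof.
move=> oa /andP[od obc]; rewrite /cubic_form !odd_abszE oa od /=.
by move: obc; do 4 case: (odd _).
Qed.

Lemma dvd3_logn_cubic_form (a b c d x y : int) :
  odd `|a| -> odd `|d| && (odd `|b| (+) odd `|c|) ->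
  (3 %| logn 2 `|cubic_form a b c d x y|)%N.
Proof.
move=> oa obcd; have [n] := ubnP (logn 2 `|cubic_form a b c d x y|).
elim: n x y => // n IHn x y.
(* The value 0 is harmless by the convention [logn 2 0 = 0]. *)
have [-> | F_neq0] := eqVneq (cubic_form a b c d x y) 0; first by rewrite logn0.
have [oF | eF] := boolP (odd `|cubic_form a b c d x y|).
  by rewrite lognE dvdn2 oF andbF.
have /andP[/even_absz_ex[x' xE] /even_absz_ex[y' yE]] :=
  cubic_form_even oa obcd eF.
have FE : cubic_form a b c d x y = 8 * cubic_form a b c d x' y'.
  by rewrite xE yE /cubic_form; ring.
have F'_gt0 : (0 < `|cubic_form a b c d x' y'|)%N.
  by move: F_neq0; rewrite FE mulf_eq0 absz_gt0.
(* Halving $x$ and $y$ lowers the valuation by exactly 3, which feeds the induction. *)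
rewrite FE abszM lognM // (_ : `|8|%N = 2 ^ 3)%N // pfactorK // => lt_n.
by rewrite dvdn_addr // IHn // -ltnS (leq_trans _ lt_n) // ltnS ltnW // ltnS.
Qed.

Theorem theorem1 (a b c d k : int)
  (k_neq0 : k != 0)
  (k_val : ~~ (3 %| logn 2 `|k|)%N)
  (a_odd : odd `|a|%N)
  (bcd_odd : odd `|(b * c + d)%R|%N)
  (p_irr : irreducible_poly (cubic a%:~R b%:~R c%:~R d%:~R : {poly rat}))
  (p_disc : exists m : int,
     discriminant (cubic a%:~R b%:~R c%:~R d%:~R : {poly rat})
       = (m ^+ 2)%:~R) :
  ~ exists x y : int,
      a * x ^+ 3 + b * x ^+ 2 * y + c * x * y ^+ 2 + d * y ^+ 3 = k.
Proof.
case=> x [y kE]; have [m Dm] := p_disc.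
have a_neq0 : a != 0 by apply: contraTneq a_odd => ->.
have {}Dm : cubic_disc a b c d = m ^+ 2.
  (* The closed formula, valid as $a \neq 0$, is pulled back from [rat] to [int] by injectivity of
     the cast. *)
  apply: (@intr_inj rat); rewrite -Dm discriminant_cubic ?intr_eq0 //.
  by rewrite /cubic_disc; ring.
have obcd := cubic_disc_sqr_parity a_odd bcd_odd Dm.
by move/negP: k_val; apply; rewrite -kE dvd3_logn_cubic_form.
Qed.
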